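(* Let $\mathcal{S}$ be the class of all Stalnakerian selection frames. Then the logic $\mathsf{L}(\mathcal{S})$, i.e. the set of all formulas of the language $\mathcal{L}$ of quantified conditional logic that are valid in every Stalnakerian selection frame, is not recursively axiomatizable.
   Context: Language. There are countably many individual variables and, for each $n$, countably many $n$-place predicates. Formulas of $\mathcal{L}$: $\phi ::= P^n(x_1,\dots,x_n) \mid \neg\phi \mid (\phi\to\phi)\mid(\phi > \phi)\mid \forall x\,\phi$, where $>$ is a binary (conditional) connective. There is no identity symbol. Frames. A selection frame is $\mathcal{F}=\langle W,R,f,D,d\rangle$ where $W\neq\varnothing$ is a set (worlds), $R\subseteq W\times W$, $f:\mathcal{P}(W)\times W\to\mathcal{P}(W)$, $D\neq\varnothing$ is a set, $d:W\to\mathcal{P}(D)$ (local domains may be empty), and $f(P,w)\subseteq R(w):=\{x\in W\mid wRx\}$ for all $P\subseteq W$, $w\in W$. It is Stalnakerian if for all $P,Q\subseteq W$, $w\in W$: (1) $f(P,w)\subseteq P$; (2) if $w\in P$ then $w\in f(P,w)$; (3) if $f(P,w)=\varnothing$ then $P\cap R(w)=\varnothing$; (4) if $f(P,w)\subseteq Q$ and $f(Q,w)\subseteq P$ then $f(P,w)=f(Q,w)$; (5) $|f(P,w)|\le 1$. Models. A model $\mathcal{M}$ based on $\mathcal{F}$ adds an interpretation $I$ with $I(P^n,w)\subseteq D^n$ for each $n$-place predicate $P^n$ and $w\in W$. A variable assignment $g$ maps variables into $D$; $g^x_a$ is $g$ changed to send $x$ to $a$. Satisfaction, with $[\phi]^g=\{w\in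 W\mid \mathcal{M},w,g\Vdash\phi\}$: $\mathcal{M},w,g\Vdash P^n(x_1,\dots,x_n)$ iff $\langle g(x_1),\dots,g(x_n)\rangle\in I(P^n,w)$; $\neg,\to$ are classical at each world; $\mathcal{M},w,g\Vdash\forall x\phi$ iff $\mathcal{M},w,g^x_a\Vdash\phi$ for all $a\in d(w)$; $\mathcal{M},w,g\Vdash\phi>\psi$ iff $f([\phi]^g,w)\subseteq[\psi]^g$. A formula is valid in a frame if it is satisfied in every model based on it, at every world, under every assignment. For a class of frames $\mathcal{C}$, $\mathsf{L}(\mathcal{C})$ is the set of formulas valid in every frame of $\mathcal{C}$. A set of formulas is recursively axiomatizable if it is the set of theorems of a formal system with a decidable set of axioms and decidable rules of inference; equivalently, if it is recursively enumerable (under a standard coding of formulas). *)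

(* Defs.v *)
From Stdlib Require List Cantor.
From mathcomp Require Import all_boot.
From mathcomp Require Import boolp classical_sets.

Set Implicit Arguments.
Unset Strict Implicit.
Unset Printing Implicit Defensive.

Local Open Scope classical_set_scope.

(** * Language *)

(** [Atom i xs], with [xs : n.-tuple nat], is the [i]-th [n]-place predicate
    applied to the variables [xs]; the case [n = 0] is allowed. *)
Inductive form : Type :=
| Atom (n i : nat) (xs : n.-tuple nat)
| Neg (p : form)
| Imp (p q : form)
| Cond (p q : form)
| All (x : nat) (p : form).

(** * Selection frames *)

Record sel_frame : Type := SelFrame {
  world : Type;
  acc : world -> set world;                (* [acc w] is R(w) *)
  sel : set world -> world -> set world;
  dom : Type;
  ldom : world -> set dom;
  world_nonempty : inhabited world;
  dom_nonempty : inhabited dom;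
  sel_acc : forall (P : set world) (w : world), sel P w `<=` acc w
}.

Definition stalnakerian : set sel_frame := [set F |
  forall (P Q : set (world F)) (w : world F),
    [/\ sel P w `<=` P,
        P w -> sel P w w,
        sel P w = set0 -> P `&` acc w = set0,
        sel P w `<=` Q -> sel Q w `<=` P -> sel P w = sel Q w
      & is_subset1 (sel P w)]].

(** * Models and validity *)

(** [interp F] is the type of interpretations on [F]: the extension of the
    [i]-th [n]-place predicate at a world is a set of [n]-tuples over the whole
    domain, not only over the local one. *)
Definition interp (F : sel_frame) : Type :=
  forall n : nat, nat -> world F -> set (n.-tuple (dom F)).

Fixpoint sat (F : sel_frame) (I : interp F) (p : form) (g : nat -> dom F)
    (w : world F) : Prop :=
  match p with
  | Atom n i xs => I n i w (map_tuple g xs)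
  | Neg p => ~ sat I p g w
  | Imp p q => sat I p g w -> sat I q g w
  | Cond p q => sel [set v | sat I p g v] w `<=` [set v | sat I q g v]
  | All x p => forall a : dom F, ldom w a -> sat I p [eta g with x |-> a] w
  end.

Definition valid (F : sel_frame) (p : form) : Prop :=
  forall (I : interp F) (w : world F) (g : nat -> dom F), sat I p g w.

Definition logic_of (C : set sel_frame) : set form :=
  [set p | forall F : sel_frame, C F -> valid F p].

(** * Partial recursive functions *)

(** Arities are not recorded: a list of arguments is read as if it were
    continued by zeros, so a missing argument is 0 and, conversely, a function
    may ignore arguments.  In [RPrec] and [RMu] the recursion, resp. search,
    variable is the first argument. *)
Inductive recfun : Type :=
| RZero
| RSucc
| RProj (i : nat)
| RComp (f : recfun) (gs : seq recfun)
| RPrec (f g : recfun)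
| RMu (f : recfun).

Section Relations.
Variables (A B : Type).

Fixpoint all_rel (r : A -> B -> Prop) (s : seq A) (t : seq B) : Prop :=
  match s, t with
  | [::], [::] => True
  | a :: s', b :: t' => r a b /\ all_rel r s' t'
  | _, _ => False
  end.

End Relations.

Fixpoint prec_rel (f g : seq nat -> nat -> Prop) (xs : seq nat) (n y : nat)
    : Prop :=
  match n with
  | 0 => f xs y
  | m.+1 => exists2 z, prec_rel f g xs m z & g [:: m, z & xs] y
  end.

(** [reval f xs y]: the computation of [f] on [xs] terminates with value [y]. *)
Fixpoint reval (f : recfun) (xs : seq nat) (y : nat) : Prop :=
  match f with
  | RZero => y = 0
  | RSucc => y = (head 0 xs).+1
  | RProj i => y = nth 0 xs i
  | RComp f gs =>
      exists2 zs, all_rel (fun g z => reval g xs z) gs zs & reval f zs y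
  | RPrec f g => prec_rel (reval f) (reval g) (behead xs) (head 0 xs) y
  | RMu f => reval f (y :: xs) 0 /\
             forall m, m < y -> exists k, reval f (m :: xs) k.+1
  end.

Definition recursive_set (A : set nat) : Prop :=
  exists f : recfun, forall n : nat,
    (A n -> reval f [:: n] 1) /\ (~ A n -> reval f [:: n] 0).

(** * Coding *)

Definition code_pair (a b : nat) : nat := Cantor.to_nat (a, b).

Fixpoint code_seq (s : seq nat) : nat :=
  match s with
  | [::] => 0
  | x :: s' => (code_pair x (code_seq s')).+1
  end.

Fixpoint code_form (p : form) : nat :=
  match p with
  | Atom n i xs => code_pair 0 (code_pair n (code_pair i (code_seq xs)))
  | Neg p => code_pair 1 (code_form p)
  | Imp p q => code_pair 2 (code_pair (code_form p) (code_form q))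
  | Cond p q => code_pair 3 (code_pair (code_form p) (code_form q))
  | All x p => code_pair 4 (code_pair x (code_form p))
  end.

Definition code_inference (r : seq form * form) : nat :=
  code_pair (code_seq (map code_form r.1)) (code_form r.2).

(** * Formal systems *)

(** [rules (ps, q)] means that [q] may be inferred from the finite list of
    premises [ps] by one of the rules of the system. *)
Record formal_system : Type := FormalSystem {
  axioms : set form;
  rules : set (seq form * form)
}.

Inductive theorem_of (S : formal_system) : form -> Prop :=
| theorem_axiom p : axioms S p -> theorem_of S p
| theorem_rule ps q : rules S (ps, q) ->
    (forall p, List.In p ps -> theorem_of S p) -> theorem_of S q.

Definition decidable_system (S : formal_system) : Prop :=
  recursive_set (code_form @` axioms S) /\
  recursive_set (code_inference @` rules S).

Definition recursively_axiomatizable (L : set form) : Prop :=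
  exists2 S : formal_system, decidable_system S & L = [set p | theorem_of S p].

(* Main.v *)
(** In a Stalnakerian frame the selection function at [w] well-orders the worlds
    accessible from [w], and this is expressible: if every element of the local
    domain marks some world, and each nonzero element has a predecessor marking a
    closer world, then every element is reached from zero in finitely many steps.
    Together with Horn axioms for successor, pairing and list access this forces
    the local domain to be the standard natural numbers, in which the graphs of
    recursive functions, hence the theorems of a decidable formal system, are
    first-order definable.  If such a system generated the logic, then the formula
    "arithmetic implies that p holds of the number n", where n codes p and p(x)
    says that the corresponding formula built from x is not a theorem, would be
    valid exactly when it is not, as in Tarski's theorem. *)

From Stdlib Require List Cantor.
From mathcomp Require Import all_boot.
From mathcomp Require Import boolp classical_sets.
Require Import Defs.

Set Implicit Arguments.
Unset Strict Implicit.
Unset Printing Implicit Defensive.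

Local Open Scope classical_set_scope.

(** * Coding *)

Lemma code_pair_inj a b a' b' :
  code_pair a b = code_pair a' b' -> a = a' /\ b = b'.
Proof. by move=> /Cantor.to_nat_inj[-> ->]. Qed.

Lemma code_pair_surj n : exists a b, n = code_pair a b.
Proof.
exists (Cantor.of_nat n).1, (Cantor.of_nat n).2.
by rewrite /code_pair -surjective_pairing Cantor.cancel_to_of.
Qed.

(** Cantor's enumeration runs along antidiagonals. This rule reaches each pair from the preceding
    one by successors alone, so the graph of pairing can be axiomatised without addition. *)
Lemma code_pair_next a b :
  (code_pair a b).+1 = if a is a'.+1 then code_pair a' b.+1 else code_pair b.+1 0.
Proof.
rewrite -[LHS]Cantor.cancel_to_of.
have -> n : Cantor.of_nat n.+1 = let (x, y) := Cantor.of_nat n in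
    if x is x'.+1 then (x', y.+1) else (y.+1, 0) by [].
by rewrite Cantor.cancel_of_to; case: a.
Qed.

Lemma leq_code_pair a b : b <= code_pair a b.
Proof.
have /leP := Cantor.to_nat_non_decreasing a b.
by rewrite plusE; apply: leq_trans; apply: leq_addr.
Qed.

Lemma code_seq_inj : injective code_seq.
Proof.
elim=> [|x s IHs] [|y t] //= [] /code_pair_inj[-> /IHs ->] //.
Qed.

(** Since every number codes a list, a quantifier over numbers acts as one over finite lists. The
    tail of a nonzero code is a smaller number, hence the strong induction. *)
Lemma code_seq_surj n : exists s, n = code_seq s.
Proof.
elim/ltn_ind: n => -[|n] IHn; first by exists [::].
have [a [b nE]] := code_pair_surj n.
have [|s bE] := IHn b; first by rewrite ltnS nE leq_code_pair.
by exists (a :: s); rewrite /= -bE nE.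
Qed.

Lemma code_form_inj : injective code_form.
Proof.
elim=> [n i xs|p IHp|p IHp q IHq|p IHp q IHq|x p IHp]
  [n' i' xs'|p'|p' q'|p' q'|x' p'] //= /code_pair_inj[] //.
- move=> _ /code_pair_inj[nE /code_pair_inj[<- /code_seq_inj]].
  by case: n' / nE xs' => xs' /val_inj ->.
- by move=> _ /IHp ->.
- by move=> _ /code_pair_inj[/IHp -> /IHq ->].
- by move=> _ /code_pair_inj[/IHp -> /IHq ->].
- by move=> _ /code_pair_inj[-> /IHp ->].
Qed.

(** The bound on [i] keeps the default of [nth] out of sight: positions outside the list have no
    entry. *)
Definition seq_nth (s i x : nat) : Prop :=
  exists l, [/\ s = code_seq l, i < size l & nth 0 l i = x].

Lemma seq_nth0 i x : ~ seq_nth 0 i x.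
Proof. by case=> -[|y l] []. Qed.

Lemma seq_nth_head a t x : seq_nth (code_pair a t).+1 0 x <-> a = x.
Proof.
split=> [[[|y l] [] //= [] /code_pair_inj[-> _] _ //]|->].
by have [l ->] := code_seq_surj t; exists (x :: l).
Qed.

Lemma seq_nth_tail a t i x : seq_nth (code_pair a t).+1 i.+1 x <-> seq_nth t i x.
Proof.
split=> [[[|y l] [] //= [] /code_pair_inj[_ ->] il xE]|[l [-> il xE]]].
  by exists l.
by exists (a :: l).
Qed.

Lemma seq_nth_code l i x : seq_nth (code_seq l) i x <-> i < size l /\ nth 0 l i = x.
Proof.
split=> [[l' [/code_seq_inj <-]] //|[]]; by exists l.
Qed.

(** * The axioms of arithmetic *)

Definition Zero (x : nat) := @Atom 1 0 [tuple x].
(** The only predicate that the axioms place under a conditional, hence the only one whose extension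
    at other worlds matters. *)
Definition Mark (x : nat) := @Atom 1 1 [tuple x].
Definition Succ (x y : nat) := @Atom 2 0 [tuple x; y].
Definition Equal (x y : nat) := @Atom 2 1 [tuple x; y].
Definition Pair (x y z : nat) := @Atom 3 0 [tuple x; y; z].
Definition Nth (s i x : nat) := @Atom 3 1 [tuple s; i; x].

Definition Ex x p := Neg (All x (Neg p)).
Definition And p q := Neg (Imp p (Neg q)).
Definition alls n p := foldr All p (iota 0 n).

Definition horn n (ps : seq form) (q : form) := alls n (foldr Imp q ps).

(* The closest world marking [x] or [y] does not mark [x]. *)
Definition mark_before y x := Cond (Imp (Neg (Mark x)) (Mark y)) (Neg (Mark x)).

(* A Horn clause whose conclusion negates one of its premises stands for one with
   conclusion falsity. *)
Definition arith_axioms : seq form := [::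
  Ex 0 (Zero 0);
  All 0 (Ex 1 (Succ 0 1));
  All 0 (Neg (Cond (Mark 0) (Neg (Mark 0))));
  All 0 (Imp (Neg (Zero 0)) (Ex 1 (And (Succ 1 0) (mark_before 1 0))));
  horn 2 [:: Succ 0 1; Zero 1] (Neg (Zero 1));
  horn 2 [:: Zero 0; Zero 1] (Equal 0 1);
  horn 2 [:: Equal 0 1; Zero 0] (Zero 1);
  horn 2 [:: Equal 0 1; Zero 1] (Zero 0);
  horn 4 [:: Succ 0 2; Succ 1 3; Equal 0 1] (Equal 2 3);
  horn 4 [:: Succ 0 2; Succ 1 3; Equal 2 3] (Equal 0 1);
  horn 3 [:: Equal 0 1; Succ 1 2] (Succ 0 2);
  horn 3 [:: Zero 0; Zero 1; Zero 2] (Pair 0 1 2);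
  horn 6 [:: Pair 0 1 2; Succ 2 5; Zero 0; Succ 1 3; Zero 4] (Pair 3 4 5);
  horn 6 [:: Pair 0 1 2; Succ 2 5; Succ 3 0; Succ 1 4] (Pair 3 4 5);
  horn 5 [:: Pair 0 1 2; Pair 3 4 2] (Equal 0 3);
  horn 5 [:: Pair 0 1 2; Pair 3 4 2] (Equal 1 4);
  horn 5 [:: Succ 1 0; Pair 2 3 1; Zero 4] (Nth 0 4 2);
  horn 7 [:: Succ 1 0; Pair 2 3 1; Nth 3 4 5; Succ 4 6] (Nth 0 6 5);
  horn 3 [:: Nth 0 1 2; Zero 0] (Neg (Zero 0));
  horn 6 [:: Nth 0 4 5; Zero 4; Succ 1 0; Pair 2 3 1] (Equal 2 5);
  horn 7 [:: Nth 0 6 5; Succ 4 6; Succ 1 0; Pair 2 3 1] (Nth 3 4 5)].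

(** A tautology serves as the empty conjunction. *)
Definition arith : form := foldr And (Imp (Zero 0) (Zero 0)) arith_axioms.

(** * Satisfaction of the derived connectives and of the axioms *)

Lemma sat_imp F (I : interp F) p q g w :
  sat I (Imp p q) g w <-> (sat I p g w -> sat I q g w).
Proof. by []. Qed.

Lemma sat_all F (I : interp F) x p g w :
  sat I (All x p) g w <-> forall a, ldom w a -> sat I p [eta g with x |-> a] w.
Proof. by []. Qed.

Lemma sat_and F (I : interp F) p q g w :
  sat I (And p q) g w <-> sat I p g w /\ sat I q g w.
Proof.
split=> [h|[hp hq] /= h]; last exact: h.
by split; apply: contrapT => /= hn; apply: h => //= hp // /hn.
Qed.

Lemma sat_ex F (I : interp F) x p g w :
  sat I (Ex x p) g w <-> exists2 a, ldom w a & sat I p [eta g with x |-> a] w.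
Proof.
split=> [h|[a da ha] /= h]; last exact: (h a da).
by apply: contrapT => hn; apply: h => a da ha; apply: hn; exists a.
Qed.

Lemma sat_arith F (I : interp F) g w :
  sat I arith g w <-> List.Forall (fun p => sat I p g w) arith_axioms.
Proof.
rewrite /arith; elim: arith_axioms => [|p ps IHps].
  by split=> _; [exact: List.Forall_nil | move=> /=].
have -> : foldr And (Imp (Zero 0) (Zero 0)) (p :: ps) =
  And p (foldr And (Imp (Zero 0) (Zero 0)) ps) by [].
rewrite sat_and IHps List.Forall_cons_iff; tauto.
Qed.

Lemma map_tuple1 T (g : nat -> T) x : map_tuple g [tuple x] = [tuple g x].
Proof. exact: val_inj. Qed.
Lemma map_tuple2 T (g : nat -> T) x y : map_tuple g [tuple x; y] = [tuple g x; g y].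
Proof. exact: val_inj. Qed.
Lemma map_tuple3 T (g : nat -> T) x y z :
  map_tuple g [tuple x; y; z] = [tuple g x; g y; g z].
Proof. exact: val_inj. Qed.
Definition map_tupleE := (map_tuple1, map_tuple2, map_tuple3).

(** [v] reads elements of the local domain as numbers. It need not be injective: without identity in
    the language, [Equal] can only mean equality of values. *)
Definition std (F : sel_frame) (I : interp F) (w : world F) (v : dom F -> nat) :=
  (forall n, exists2 a, ldom w a & v a = n) /\
  forall a b c, ldom w a -> ldom w b -> ldom w c ->
  [/\ I 1 0 w [tuple a] <-> v a = 0,
      I 2 0 w [tuple a; b] <-> v b = (v a).+1,
      I 2 1 w [tuple a; b] <-> v a = v b,
      I 3 0 w [tuple a; b; c] <-> v c = code_pair (v a) (v b)
    & I 3 1 w [tuple a; b; c] <-> seq_nth (v a) (v b) (v c)].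

(** * Standardness of the models *)

Section Standardness.
Variables (F : sel_frame) (I : interp F) (w : world F).
Arguments I : clear implicits.
Hypothesis stF : stalnakerian F.
Hypothesis satI : exists g, sat I arith g w.

Let d := ldom w.
Let Z a := I 1 0 w [tuple a].
Let S a b := I 2 0 w [tuple a; b].
Let E a b := I 2 1 w [tuple a; b].
Let P a b c := I 3 0 w [tuple a; b; c].
Let N a b c := I 3 1 w [tuple a; b; c].

(** Having a value means being reached from a zero in finitely many successor steps. It is a
    relation because existence and uniqueness of values are what has to be proved. *)
Inductive value : dom F -> nat -> Prop :=
| value0 a : d a -> Z a -> value a 0
| valueS a b n : value a n -> d b -> S a b -> value b n.+1.

Lemma value_dom a n : value a n -> d a.
Proof. by case. Qed.

(** The numerals passed to [axiom] and [use_horn] below are positions in [arith_axioms], counted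
    from 0. *)
Let axiom k p : List.nth_error arith_axioms k = Some p -> exists g, sat I p g w.
Proof.
move=> kE; have pk := List.nth_error_In _ _ kE; have [g /sat_arith/List.Forall_forall h] := satI.
by exists g; apply: h.
Qed.

Let ax_marked x : d x -> exists2 u, sel [set u | I 1 1 u [tuple x]] w u & I 1 1 u [tuple x].
Proof.
(* A failing conditional provides a selected world that refutes its consequent, here a world marking
   [x]. *)
move=> dx; have [g /(_ x dx) /=] := @axiom 2 _ erefl.
under eq_set do rewrite map_tupleE /=.
move=> /existsNP[u /not_implyP[hu]]; rewrite /= map_tupleE => /contrapT ?.
by exists u.
Qed.

Let ax_pred x : d x -> ~ Z x -> exists2 y, d y /\ S y x &
  sel [set u | I 1 1 u [tuple x] \/ I 1 1 u [tuple y]] w `<=` [set u | ~ I 1 1 u [tuple x]].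
Proof.
move=> dx nZx; have [g /sat_all/(_ x dx)/sat_imp h] := @axiom 3 _ erefl.
have {h}/h/sat_ex[y dy /sat_and[/= Syx hM]] : sat I (Neg (Zero 0)) [eta g with 0 |-> x] w.
  by rewrite /= map_tupleE.
exists y; first by rewrite map_tupleE in Syx.
move: hM.
(* [A] is the antecedent as the axiom writes it, [A'] the disjunction; they agree classically. *)
set A := (X in sel X); set A' := (X in _ -> sel X _ `<=` _).
have -> : A = A'.
  apply/seteqP; split=> u; rewrite /A /A' /= !map_tupleE /=.
    by move=> h; case: (pselect (I 1 1 u [tuple x])) => [|/h]; [left|right].
  by case=> [h /(_ h)|].
by move=> h u /h /=; rewrite map_tupleE.
Qed.

(** Instantiates the quantifiers of the axiom in the order of the hypotheses [d _], which therefore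
    follows the numbering of its variables. *)
Local Ltac use_horn k :=
  let g := fresh "g" in let H := fresh "H" in
  have [g H] := @axiom k _ erefl; rewrite /horn /alls /= in H;
  do ?[move=> ?];
  repeat match reverse goal with
  | h : d ?a |- _ => specialize (H a h); clear h
  end;
  rewrite !map_tupleE /= in H; apply: H => //.

Let ax_succ_neq0 x y : d x -> d y -> S x y -> Z y -> False.
Proof. by use_horn 4. Qed.
Let ax_eq00 x y : d x -> d y -> Z x -> Z y -> E x y.
Proof. by use_horn 5. Qed.
Let ax_eq0r x y : d x -> d y -> E x y -> Z x -> Z y.
Proof. by use_horn 6. Qed.
Let ax_eq0l x y : d x -> d y -> E x y -> Z y -> Z x.
Proof. by use_horn 7. Qed.
Let ax_eqS x y x' y' : d x -> d y -> d x' -> d y' ->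
  S x x' -> S y y' -> E x y -> E x' y'.
Proof. by use_horn 8. Qed.
Let ax_eqSS x y x' y' : d x -> d y -> d x' -> d y' ->
  S x x' -> S y y' -> E x' y' -> E x y.
Proof. by use_horn 9. Qed.
Let ax_succ_eq x x' y : d x -> d x' -> d y -> E x x' -> S x' y -> S x y.
Proof. by use_horn 10. Qed.
Let ax_pair00 x y z : d x -> d y -> d z -> Z x -> Z y -> Z z -> P x y z.
Proof. by use_horn 11. Qed.
Let ax_pair0S x y z x' y' z' : d x -> d y -> d z -> d x' -> d y' -> d z' ->
  P x y z -> S z z' -> Z x -> S y x' -> Z y' -> P x' y' z'.
Proof. by use_horn 12. Qed.
Let ax_pairSS x y z x' y' z' : d x -> d y -> d z -> d x' -> d y' -> d z' ->
  P x y z -> S z z' -> S x' x -> S y y' -> P x' y' z'.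
Proof. by use_horn 13. Qed.
Let ax_pair_fst x y z x' y' : d x -> d y -> d z -> d x' -> d y' ->
  P x y z -> P x' y' z -> E x x'.
Proof. by use_horn 14. Qed.
Let ax_pair_snd x y z x' y' : d x -> d y -> d z -> d x' -> d y' ->
  P x y z -> P x' y' z -> E y y'.
Proof. by use_horn 15. Qed.
Let ax_nth_head s p a t i : d s -> d p -> d a -> d t -> d i ->
  S p s -> P a t p -> Z i -> N s i a.
Proof. by use_horn 16. Qed.
Let ax_nth_tail s p a t i x j : d s -> d p -> d a -> d t -> d i -> d x -> d j ->
  S p s -> P a t p -> N t i x -> S i j -> N s j x.
Proof. by use_horn 17. Qed.
Let ax_nth_nil s i x : d s -> d i -> d x -> N s i x -> Z s -> False.
Proof. by use_horn 18. Qed.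
Let ax_nth_head_inv s p a t i x : d s -> d p -> d a -> d t -> d i -> d x ->
  N s i x -> Z i -> S p s -> P a t p -> E a x.
Proof. by use_horn 19. Qed.
Let ax_nth_tail_inv s p a t i x j : d s -> d p -> d a -> d t -> d i -> d x -> d j ->
  N s j x -> S i j -> S p s -> P a t p -> N t i x.
Proof. by use_horn 20. Qed.

(* The closest world marking an element without a value marks some such [x]; but
   the predecessor of [x] has no value either and is marked at a closer world
   that does not mark [x]. *)
Lemma value_total a : d a -> exists n, value a n.
Proof.
move=> da; apply: contrapT => na.
pose bad x := d x /\ ~ exists n, value x n.
pose B := [set u | exists2 x, bad x & I 1 1 u [tuple x]].
have [ua selua Ma] := ax_marked da.
(* The third frame condition applies, because the accessible world [ua] marks the bad element
   [a]. *)
have [v selBv] : exists v, sel B w v.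
  have [_ _ + _ _] := stF B B w.
  apply: contraPP => /forallNP Bw0 /(_ _) h.
  have : (B `&` acc w) ua by split; [exists a | exact: sel_acc selua].
  by rewrite h //; apply/seteqP; split=> // u /Bw0.
have [/(_ _ selBv)[x [dx nx] Mx] _ _ _ subB] := stF B B w.
have nZx : ~ Z x by move=> Zx; apply: nx; exists 0; exact: value0.
have [y [dy Syx] closer] := ax_pred dx nZx.
have bady : bad y.
  by split=> // -[n yn]; apply: nx; exists n.+1; exact: valueS yn dx Syx.
set C := [set u | _] in closer.
have CB : sel C w `<=` B.
  have [+ _ _ _ _] := stF C C w => selC u Cu.
  by case: (selC u Cu) => ?; [exists x | exists y].
(* [v] is the only world selected for [B], and it marks [x]. Together with [CB], the fourth frame
   condition then identifies the two selections. *)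
have BC : sel B w `<=` C by move=> u Bu; rewrite (subB _ _ Bu selBv); left.
have [_ _ _ /(_ CB BC) CBE _] := stF C B w.
by apply: (closer v) Mx; rewrite CBE.
Qed.

(** Descent along both successor chains at once: [Equal] is preserved and reflected by successor,
    respects being zero, and no successor is zero. *)
Lemma value_eq a b n m : value a n -> value b m -> (E a b <-> n = m).
Proof.
move=> an; elim: an b m => {a n} [a da Za|a a' n an IHn da' Sa] b m bm.
  have db := value_dom bm; case: bm db => {b m} [b _ Zb|b b' m bm db' Sb] db.
    by split=> // _; exact: ax_eq00.
  split=> // ab; case: (ax_succ_neq0 (value_dom bm) db' Sb).
  exact: ax_eq0r ab Za.
have da := value_dom an; have db := value_dom bm.
case: bm db => {b m} [b _ Zb|b b' m bm db' Sb] db.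
  split=> // ab; case: (ax_succ_neq0 da da' Sa); exact: ax_eq0l ab Zb.
have {}IHn := IHn _ _ bm; have db0 := value_dom bm.
split=> [ab|[/IHn ab]]; last exact: ax_eqS Sa Sb ab.
by congr _.+1; apply/IHn; exact: ax_eqSS Sa Sb ab.
Qed.

(** The first derivation yields [E a a], which then forces the two values to agree. *)
Lemma value_inj a n m : value a n -> value a m -> n = m.
Proof. by move=> an am; apply/(value_eq an am)/(value_eq an an). Qed.

Lemma value_zero a n : value a n -> (Z a <-> n = 0).
Proof.
move=> an; split=> [Za|n0]; first exact: value_inj an (value0 (value_dom an) Za).
by rewrite n0 in an; inversion an.
Qed.

Lemma value_succ a b n m : value a n -> value b m -> (S a b <-> m = n.+1).
Proof.
move=> an bm; have da := value_dom an; have db := value_dom bm.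
split=> [Sab|mE]; first exact: value_inj bm (valueS an db Sab).
(* [b] was reached from some [a'] with the same value as [a]; the two are [Equal], so the successor
   step transfers to [a]. *)
rewrite mE in bm; inversion bm as [|a' ? ? a'n _ Sa'b].
by apply: ax_succ_eq Sa'b => //; [exact: value_dom a'n | exact/(value_eq an a'n)].
Qed.

Lemma value_surj n : exists a, value a n.
Proof.
elim: n => [|n [a an]].
  have [g /sat_ex[a da]] := @axiom 0 _ erefl; rewrite /= map_tupleE => Za.
  by exists a; exact: value0.
have [g /sat_all/(_ a (value_dom an))/sat_ex[b db]] := @axiom 1 _ erefl.
by rewrite /= map_tupleE => Sab; exists b; exact: valueS an db Sab.
Qed.

(** Induction along Cantor's enumeration: the preceding pair and its code are realised by elements
    of the local domain, and the step axioms lead from them to [a], [b], [c]. *)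
Lemma value_pair_intro a b c k l : value a k -> value b l -> value c (code_pair k l) ->
  P a b c.
Proof.
move=> ak bl cn; set n := code_pair k l in cn.
have nE : n = code_pair k l by []; move: n cn nE => n cn nE.
elim: n a b c k l ak bl cn nE => [|n IHn] a b c k l ak bl cn nE.
  have [k0 l0] : k = 0 /\ l = 0 by apply: code_pair_inj; rewrite -nE.
  subst k l; apply: ax_pair00; by [exact: value_dom ak|exact: value_dom bl|
    exact: value_dom cn|exact/(value_zero ak)|exact/(value_zero bl)|exact/(value_zero cn)].
have [k' [l' n'E]] := code_pair_surj n.
have [a' a'k'] := value_surj k'; have [b' b'l'] := value_surj l'.
have [c' c'n] := value_surj n.
have Pn := IHn _ _ _ _ _ a'k' b'l' c'n n'E.
have Scc' : S c' c by apply/(value_succ c'n cn).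
have [da db dc] := And3 (value_dom ak) (value_dom bl) (value_dom cn).
have [da' db' dc'] := And3 (value_dom a'k') (value_dom b'l') (value_dom c'n).
move: nE; rewrite n'E code_pair_next.
case: k' a'k' n'E => [|k'] a'k' n'E /code_pair_inj[kE lE].
  apply: (ax_pair0S da' db' dc' da db dc Pn Scc').
  - exact/(value_zero a'k').
  - exact/(value_succ b'l' ak).
  - exact/(value_zero bl).
apply: (ax_pairSS da' db' dc' da db dc Pn Scc').
  by apply/(value_succ ak a'k'); rewrite kE.
exact/(value_succ b'l' bl).
Qed.

(** For the converse, [c] also codes the pair into which [n] decodes, and the axioms make the
    components of a code unique up to [Equal]. *)
Lemma value_pair a b c k l n : value a k -> value b l -> value c n ->
  (P a b c <-> n = code_pair k l).
Proof.
move=> ak bl cn; split=> [Pabc|nE]; last by rewrite nE in cn; exact: value_pair_intro cn.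
have [k' [l' nE]] := code_pair_surj n; rewrite nE in cn.
have [a' a'k'] := value_surj k'; have [b' b'l'] := value_surj l'.
have P' := value_pair_intro a'k' b'l' cn.
have [da db dc] := And3 (value_dom ak) (value_dom bl) (value_dom cn).
have [da' db'] := conj (value_dom a'k') (value_dom b'l').
rewrite nE; congr code_pair; symmetry.
  exact/(value_eq ak a'k')/(ax_pair_fst da db dc da' db' Pabc P').
exact/(value_eq bl b'l')/(ax_pair_snd da db dc da' db' Pabc P').
Qed.

(** Induction on the index. The empty list has no entries; a nonzero code splits as
    [(code_pair a t).+1], realised by [p], [a'] and [t'], to which the head and tail axioms apply in
    both directions. *)
Lemma value_nth s i x k l n : value s k -> value i l -> value x n ->
  (N s i x <-> seq_nth k l n).
Proof.
elim: l s i k => [|l IHl] s i k sk il xn;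
  (have [ds di dx] := And3 (value_dom sk) (value_dom il) (value_dom xn));
  (case: k sk => [|k] sk; first by
    split=> [Nsix|/seq_nth0//]; case: (ax_nth_nil ds di dx Nsix); exact/(value_zero sk));
  have [a [t kE]] := code_pair_surj k; rewrite kE in sk *;
  have [p pk] := value_surj (code_pair a t);
  have [a' a'a] := value_surj a; have [t' t't] := value_surj t;
  (have Sps : S p s by apply/(value_succ pk sk));
  have Patp := value_pair_intro a'a t't pk;
  have [dp da' dt'] := And3 (value_dom pk) (value_dom a'a) (value_dom t't).
- have Zi : Z i by exact/(value_zero il).
  rewrite seq_nth_head; split=> [Nsix|an].
    exact/(value_eq a'a xn)/(ax_nth_head_inv ds dp da' dt' di dx Nsix Zi Sps Patp).
  (* [x] has the value of the head, so it can itself play the head in the pair. *)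
  rewrite -an in xn; have Pxtp := value_pair_intro xn t't pk.
  exact: (ax_nth_head ds dp dx dt' di Sps Pxtp Zi).
- rewrite seq_nth_tail; have [i' i'l] := value_surj l; have di' := value_dom i'l.
  have Sii' : S i' i by apply/(value_succ i'l il).
  rewrite -(IHl t' i' t t't i'l xn); split=> [Nsix|Nt].
    exact: (ax_nth_tail_inv ds dp da' dt' di' dx di Nsix Sii' Sps Patp).
  exact: (ax_nth_tail ds dp da' dt' di' dx di Sps Patp Nt Sii').
Qed.

Lemma std_of_arith : exists v, std I w v.
Proof.
have /choice[v vP] : forall a, exists n, d a -> value a n.
  (* Outside the local domain the value is set to 0; [std] never consults it. *)
  move=> a; case: (pselect (d a)) => [/value_total[n an]|na]; last by exists 0.
  by exists n.
exists v; split=> [n|a b c /vP av /vP bv /vP cv].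
  have [a an] := value_surj n; exists a; first exact: value_dom an.
  exact: value_inj (vP _ (value_dom an)) an.
by split; [exact: value_zero|exact: value_succ|exact: value_eq|
           exact: value_pair|exact: value_nth].
Qed.

End Standardness.

(** * The standard model *)

(** Selects the least element of [P] in the well-order that puts [w] first and keeps the usual order
    on the rest. *)
Definition nearest (P : set nat) (w : nat) : set nat :=
  [set u | P u /\ if `[< P w >] then u = w else forall v, P v -> u <= v].

Definition nat_frame : sel_frame :=
  @SelFrame nat (fun=> setT) nearest nat (fun=> setT) (inhabits 0) (inhabits 0)
    (fun P w => @subsetT _ (nearest P w)).

Lemma nearest_subset1 P w : is_subset1 (nearest P w).
Proof.
move=> u v [Pu hu] [Pv hv]; move: hu hv; case: asboolP => _; first by move=> -> ->.
by move=> /(_ v Pv) uv /(_ u Pu) vu; apply/eqP; rewrite eqn_leq uv vu.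
Qed.

Lemma nearest_nonempty P w u : P u -> exists v, nearest P w v.
Proof.
move=> Pu; case: (pselect (P w)) => Pw.
  by exists w; split=> //; rewrite asboolT.
have exP : exists v, `[< P v >] by exists u; exact/asboolP.
exists (ex_minn exP); case: ex_minnP => v /asboolP Pv vmin; split=> //.
by rewrite asboolF // => z Pz; apply: vmin; exact/asboolP.
Qed.

Lemma nat_frame_stalnakerian : stalnakerian nat_frame.
Proof.
move=> P Q w; split=> /=.
- by move=> u [].
- by move=> Pw; split=> //; rewrite asboolT.
- move=> P0; apply/seteqP; split=> // u [Pu _].
  by have [v] := nearest_nonempty w Pu; rewrite P0.
(* The fourth condition is symmetric, so one inclusion suffices. *)
- have sub A B : nearest A w `<=` B -> nearest B w `<=` A ->
      nearest A w `<=` nearest B w.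
    move=> AB BA u Au; have [v Bv] := nearest_nonempty w (AB _ Au).
    rewrite (_ : u = v) //; move: (Au) (Bv) => [_ hu] [_ hv].
    move: hu hv; case: asboolP => Aw; case: asboolP => Bw.
    + by move=> -> ->.
    + by case: Bw; apply: AB; split=> //; rewrite asboolT.
    + by case: Aw; apply: BA; split=> //; rewrite asboolT.
    + move=> /(_ _ (BA _ Bv)) uv /(_ _ (AB _ Au)) vu.
      by apply/eqP; rewrite eqn_leq uv vu.
  by move=> PQ QP; apply/seteqP; split; exact: sub.
- exact: nearest_subset1.
Qed.

(** World [n] marks exactly the number [n], so seen from world 0 smaller numbers are marked closer.
    The other predicates do not vary with the world. *)
Definition nat_interp : interp nat_frame := fun n i w =>
  match n, i with
  | 1, 0 => [set xs | nth 0 xs 0 = 0]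
  | 1, 1 => [set xs | nth 0 xs 0 = w]
  | 2, 0 => [set xs | nth 0 xs 1 = (nth 0 xs 0).+1]
  | 2, 1 => [set xs | nth 0 xs 1 = nth 0 xs 0]
  | 3, 0 => [set xs | nth 0 xs 2 = code_pair (nth 0 xs 0) (nth 0 xs 1)]
  | 3, 1 => [set xs | seq_nth (nth 0 xs 0) (nth 0 xs 1) (nth 0 xs 2)]
  | _, _ => set0
  end.

Lemma nat_interp_std : std nat_interp 0 id.
Proof.
split=> [n|a b c _ _ _]; first by exists n.
by split=> //=; split.
Qed.

Lemma nat_interp_arith g : sat nat_interp arith g 0.
Proof.
apply/sat_arith; repeat apply: List.Forall_cons; try exact: List.Forall_nil.
- by apply/sat_ex; exists 0.
- by apply/sat_all => a _; apply/sat_ex; exists a.+1.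
- move=> a _ /= aM; have [u au] := @nearest_nonempty [set v | a = v] 0 a erefl.
  by apply: (aM u au); case: au.
- apply/sat_all => a _; apply/sat_imp => aZ; apply/sat_ex; exists a.-1 => //; apply/sat_and.
  have {aZ}a0 : 0 < a by case: a aZ => // -[].
  split=> /=; first by rewrite prednK.
  (* Suppose the selected world were [a]. If world 0 satisfies the antecedent then [a] is 0;
     otherwise minimality gives [a <= a.-1]. Both contradict [0 < a]. *)
  move=> u [/= _ +] au; move: au => <- {u}.
  case: asboolP => [_ aE|_ /(_ a.-1 (fun=> erefl))]; first by rewrite aE in a0.
  by rewrite -ltnS prednK // ltnn.
(* The Horn axioms become the recursion equations of [code_pair] and [seq_nth]. *)
all: rewrite /horn /alls /=; intros; subst; simpl in *; rewrite ?seq_nth_head ?seq_nth_tail //.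
all: rewrite ?code_pair_next //; try congruence.
all: match goal with
  | h : code_pair _ _ = code_pair _ _ |- _ => by case/code_pair_inj: h
  | h : seq_nth 0 _ _ |- _ => by case/seq_nth0: h
  | h : seq_nth _ _ _ |- _ => by move: h; rewrite ?seq_nth_head ?seq_nth_tail
  end.
Qed.

(** * Definability *)

(* In the environment [e : E], variable [i < ctx_size c] denotes [ctx_val c e i]. *)
Record ctx (E : Type) := Ctx { ctx_size : nat; ctx_val : E -> nat -> nat }.

Definition ext E (c : ctx E) : ctx (E * nat) :=
  Ctx (ctx_size c).+1 (fun p => [eta ctx_val c p.1 with ctx_size c |-> p.2]).

(** Without function symbols, an atom can only speak of values of variables; any other number is
    first introduced by a quantifier. *)
Definition var E (c : ctx E) (u : E -> nat) :=
  exists2 i, i < ctx_size c & forall e, u e = ctx_val c e i.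

Definition vars E (c : ctx E) (us : E -> seq nat) :=
  exists2 ks, all (fun i => i < ctx_size c) ks & forall e, us e = map (ctx_val c e) ks.

Lemma var_last E (c : ctx E) : var (ext c) snd.
Proof. by exists (ctx_size c) => //= e; rewrite eqxx. Qed.

Lemma var_ext E (c : ctx E) u u' : var c u -> (forall p, u' p = u p.1) -> var (ext c) u'.
Proof.
move=> [i ic uE] u'E; exists i => [|p] /=; first exact: ltnW.
by rewrite u'E uE ifN // neq_ltn ic.
Qed.

Lemma vars_ext E (c : ctx E) us us' :
  vars c us -> (forall p, us' p = us p.1) -> vars (ext c) us'.
Proof.
move=> [ks /allP ksc usE] us'E; exists ks => [|p].
  by apply/allP => i /ksc /=; exact: ltnW.
rewrite us'E usE; apply/eq_in_map => i /ksc ic /=.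
by rewrite ifN // neq_ltn ic.
Qed.

Lemma vars_nil E (c : ctx E) : vars c (fun=> [::]).
Proof. by exists [::]. Qed.

Lemma vars_cons E (c : ctx E) u us : var c u -> vars c us -> vars c (fun e => u e :: us e).
Proof.
move=> [i ic uE] [ks ksc usE]; exists (i :: ks) => /=; first by rewrite ic.
by move=> e; rewrite uE usE.
Qed.

Lemma vars_rcons E (c : ctx E) u us :
  var c u -> vars c us -> vars c (fun e => rcons (us e) (u e)).
Proof.
move=> [i ic uE] [ks ksc usE]; exists (rcons ks i); first by rewrite all_rcons ic.
by move=> e; rewrite uE usE map_rcons.
Qed.

Lemma vars_behead E (c : ctx E) us : vars c us -> vars c (fun e => behead (us e)).
Proof.
move=> [ks ksc usE]; exists (behead ks); last by move=> e; rewrite usE; case: (ks).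
move: ksc; case: (ks) => [|k ks'] //. by case/andP.
Qed.

(** Under [ext] the underlying function is still unknown when a hypothesis is tried; only the final
    [reflexivity] confirms it, so [multimatch] is there to backtrack. *)
Ltac solve_var1 :=
  multimatch goal with
  | h : var _ _ |- var _ _ => exact h
  | |- var (ext _) _ => exact: var_last
  | |- var (ext _) _ => eapply var_ext; [solve_var1 | move=> ?; reflexivity]
  | h : vars _ _ |- vars _ _ => exact h
  | |- vars (ext _) _ => eapply vars_ext; [solve_var1 | move=> ?; reflexivity]
  end.

Ltac solve_var := cbv beta;
  lazymatch goal with
  | |- vars _ (fun _ => [::]) => exact: vars_nil
  | |- vars _ (fun _ => _ :: _) => apply: vars_cons; solve_var
  | |- vars _ (fun _ => rcons _ _) => apply: vars_rcons; solve_var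
  | |- vars _ (fun _ => behead _) => apply: vars_behead; solve_var
  | |- _ => solve [solve_var1]
  end.

(** One formula has to serve all standard worlds of all frames; its truth then depends on numbers
    only. *)
Definition definable E (c : ctx E) (R : E -> Prop) :=
  exists p, forall (F : sel_frame) (I : interp F) w v, std I w v ->
    forall e g, (forall i, i < ctx_size c -> ldom w (g i) /\ v (g i) = ctx_val c e i) ->
    sat I p g w <-> R e.

Section Definable.
Variables (E : Type) (c : ctx E).
Implicit Types (R : E -> Prop) (u : E -> nat).

Lemma definable_iff R R' : (forall e, R e <-> R' e) -> definable c R -> definable c R'.
Proof. by move=> RR' [p pP]; exists p => F I w v st e g ge; rewrite -RR'; exact: pP st _ _ ge. Qed.

Lemma definable_not R : definable c R -> definable c (fun e => ~ R e).
Proof.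
move=> [p pP]; exists (Neg p) => F I w v st e g ge.
by have := pP _ _ _ _ st _ _ ge => /=; tauto.
Qed.

Lemma definable_imp R R' : definable c R -> definable c R' -> definable c (fun e => R e -> R' e).
Proof.
move=> [p pP] [q qP]; exists (Imp p q) => F I w v st e g ge.
by have := qP _ _ _ _ st _ _ ge; have := pP _ _ _ _ st _ _ ge => /=; tauto.
Qed.

Lemma definable_and R R' : definable c R -> definable c R' -> definable c (fun e => R e /\ R' e).
Proof.
move=> [p pP] [q qP]; exists (And p q) => F I w v st e g ge.
rewrite sat_and.
by have := qP _ _ _ _ st _ _ ge; have := pP _ _ _ _ st _ _ ge => /=; tauto.
Qed.

Lemma definable_or R R' : definable c R -> definable c R' -> definable c (fun e => R e \/ R' e).
Proof.
move=> cR cR'; apply: (@definable_iff (fun e => ~ R e -> R' e)) => [e|].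
  split=> [h|[]//]; by case: (pselect (R e)) => [|/h]; [left|right].
by apply: definable_imp => //; exact: definable_not.
Qed.

(** A quantifier over the local domain amounts to one over numbers, as [v] maps the local domain
    onto them. *)
Lemma definable_ex (R : E -> nat -> Prop) :
  definable (ext c) (fun p => R p.1 p.2) -> definable c (fun e => exists y, R e y).
Proof.
move=> [p pP]; exists (Ex (ctx_size c) p) => F I w v st e g ge.
have key a : ldom w a -> sat I p [eta g with ctx_size c |-> a] w <-> R e (v a).
  move=> da; apply: (pP _ _ _ _ st (e, v a)) => i; rewrite ltnS leq_eqVlt /=.
  by case: eqVneq => // _ /ge.
rewrite sat_ex; split=> [[a da /key aR]|[y Rey]]; first by exists (v a); exact: aR.
by have [a da ay] := st.1 y; exists a => //; apply/key; rewrite ?ay.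
Qed.

End Definable.

(** * Universal quantification and the atomic relations *)

Section DefinableAtoms.
Variables (E : Type) (c : ctx E).
Implicit Types u : E -> nat.

Lemma definable_all (R : E -> nat -> Prop) :
  definable (ext c) (fun p => R p.1 p.2) -> definable c (fun e => forall y, R e y).
Proof.
move=> cR; apply: (@definable_iff _ _ (fun e => ~ exists y, ~ R e y)) => [e|].
  by split=> [h y|h [y]//]; apply: contrapT => nR; apply: h; exists y.
by apply: definable_not; apply: definable_ex; exact: definable_not.
Qed.

Lemma definable_zero u : var c u -> definable c (fun e => u e = 0).
Proof.
move=> [i ic uE]; exists (Zero i) => F I w v st e g ge; rewrite /= map_tupleE uE.
have [di <-] := ge _ ic; have [] // := st.2 (g i) (g i) (g i).
Qed.

Lemma definable_succ u u' : var c u -> var c u' -> definable c (fun e => u' e = (u e).+1).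
Proof.
move=> [i ic uE] [j jc u'E]; exists (Succ i j) => F I w v st e g ge.
rewrite /= map_tupleE uE u'E; have [di <-] := ge _ ic; have [dj <-] := ge _ jc.
by have [] := st.2 (g i) (g j) (g j).
Qed.

Lemma definable_eq u u' : var c u -> var c u' -> definable c (fun e => u e = u' e).
Proof.
move=> [i ic uE] [j jc u'E]; exists (Equal i j) => F I w v st e g ge.
rewrite /= map_tupleE uE u'E; have [di <-] := ge _ ic; have [dj <-] := ge _ jc.
by have [] := st.2 (g i) (g j) (g j).
Qed.

Lemma definable_pair u u' u'' : var c u -> var c u' -> var c u'' ->
  definable c (fun e => u'' e = code_pair (u e) (u' e)).
Proof.
move=> [i ic uE] [j jc u'E] [k kc u''E]; exists (Pair i j k) => F I w v st e g ge.
rewrite /= map_tupleE uE u'E u''E.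
have [di <-] := ge _ ic; have [dj <-] := ge _ jc; have [dk <-] := ge _ kc.
by have [] := st.2 (g i) (g j) (g k).
Qed.

Lemma definable_nth u u' u'' : var c u -> var c u' -> var c u'' ->
  definable c (fun e => seq_nth (u e) (u' e) (u'' e)).
Proof.
move=> [i ic uE] [j jc u'E] [k kc u''E]; exists (Nth i j k) => F I w v st e g ge.
rewrite /= map_tupleE uE u'E u''E.
have [di <-] := ge _ ic; have [dj <-] := ge _ jc; have [dk <-] := ge _ kc.
by have [] := st.2 (g i) (g j) (g k).
Qed.

End DefinableAtoms.

(** Arguments form a list of variables whose length does not depend on the environment, to match the
    arity-free [reval]. *)
Definition definable_rel (r : seq nat -> nat -> Prop) :=
  forall E (c : ctx E) us u, vars c us -> var c u -> definable c (fun e => r (us e) (u e)).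

Lemma definable_rel_iff r r' :
  (forall xs y, r xs y <-> r' xs y) -> definable_rel r -> definable_rel r'.
Proof. by move=> rr' rP E c us u cus cu; apply: definable_iff (rP _ _ _ _ cus cu). Qed.

Lemma definable_rel_const n : definable_rel (fun _ y => y = n).
Proof.
elim: n => [|n IHn] E c us u cus cu; first exact: definable_zero.
apply: (@definable_iff _ _ (fun e => exists z, z = n /\ u e = z.+1)) => [e|].
  by split=> [[z [->]]//|->]; exists n.
apply: definable_ex; apply: definable_and; last by apply: definable_succ; solve_var.
by apply: (IHn _ _ (fun p => us p.1)); solve_var.
Qed.

Lemma definable_rel_nth i : definable_rel (fun xs y => y = nth 0 xs i).
Proof.
move=> E c us u [ks /all_nthP ksc usE] cu; case: (ltnP i (size ks)) => [ilt|ige].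
  apply: (@definable_iff _ _ (fun e => u e = ctx_val c e (nth 0 ks i))) => [e|].
    by rewrite usE (nth_map 0).
  by apply: definable_eq => //; exists (nth 0 ks i) => //; exact: ksc.
(* A missing argument reads as 0 and has no variable. *)
apply: (@definable_iff _ _ (fun e => u e = 0)); last exact: definable_zero.
by move=> e; rewrite usE nth_default // size_map.
Qed.

Lemma definable_rel_pair h h' :
  definable_rel (fun xs y => y = h xs) -> definable_rel (fun xs y => y = h' xs) ->
  definable_rel (fun xs y => y = code_pair (h xs) (h' xs)).
Proof.
move=> hP h'P E c us u cus cu.
apply: (@definable_iff _ _ (fun e => exists a, a = h (us e) /\
  exists b, b = h' (us e) /\ u e = code_pair a b)) => [e|].
  split=> [[a [-> [b [->]]]] //|uE].
  by exists (h (us e)); split=> //; exists (h' (us e)).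
apply: definable_ex; apply: definable_and; first by apply: hP; solve_var.
apply: definable_ex; apply: definable_and; first by apply: h'P; solve_var.
by apply: definable_pair; solve_var.
Qed.

(** A recursion succeeds when some list starts with a value of [f], has its consecutive entries
    linked by [g], and shows the result at position [n]. Coded lists do the work of Gödel's beta
    function. *)
Lemma definable_rel_prec f g :
  definable_rel f -> definable_rel g ->
  forall E (c : ctx E) us n u, vars c us -> var c n -> var c u ->
  definable c (fun e => prec_rel f g (us e) (n e) (u e)).
Proof.
move=> fP gP E c us n u cus cn cu.
apply: (@definable_iff _ _ (fun e => exists s,
  ((exists z i, i = 0 /\ (seq_nth s i z /\ f (us e) z)) /\ seq_nth s (n e) (u e)) /\
  forall m m' z z', m' = m.+1 -> seq_nth s m z -> seq_nth s m' z' ->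
    g [:: m, z & us e] z')) => [e|]; last first.
  apply: definable_ex; apply: definable_and; first apply: definable_and.
  - apply: definable_ex; apply: definable_ex; apply: definable_and.
      by apply: definable_zero; solve_var.
    apply: definable_and; first by apply: definable_nth; solve_var.
    by apply: fP; solve_var.
  - by apply: definable_nth; solve_var.
  - do 4![apply: definable_all]; apply: definable_imp.
      by apply: definable_succ; solve_var.
    apply: definable_imp; first by apply: definable_nth; solve_var.
    apply: definable_imp; first by apply: definable_nth; solve_var.
    by apply: gP; solve_var.
move: (us e) (n e) (u e) => {us n u cus cn cu} xs n y.
split=> [[s [[[z0 [_ [-> [sz0 fz0]]]] sy] sg]]|].
  have [l sE] := code_seq_surj s; subst s.
  elim: n y sy => [|n IHn] y sy.
    by move: sz0 sy fz0; rewrite !seq_nth_code /= => -[_ <-] [_ <-].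
  have sn : seq_nth (code_seq l) n (nth 0 l n).
    by move: sy; rewrite !seq_nth_code => -[/ltnW].
  exists (nth 0 l n); first exact: IHn.
  exact: (sg _ _ _ _ erefl sn sy).
move=> nxy; suff [l [ln l0 ly lg]] : exists l, [/\ size l = n.+1, f xs (nth 0 l 0),
    nth 0 l n = y & forall m, m < n -> g [:: m, nth 0 l m & xs] (nth 0 l m.+1)].
  exists (code_seq l); rewrite seq_nth_code ln ltnS leqnn ly; split; [split=> //|].
    by exists (nth 0 l 0), 0; rewrite seq_nth_code ln.
  move=> m _ z z' ->; rewrite !seq_nth_code => -[_ <-] [+ <-].
  by rewrite ln ltnS; exact: lg.
elim: n y nxy => [|n IHn] y /=; first by move=> fy; exists [:: y].
move=> [z /IHn[l [ln l0 lz lg]] gy]; exists (rcons l y).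
rewrite size_rcons ln !nth_rcons ln ltnn eqxx /=; split=> // m; rewrite ltnS => mn.
rewrite !nth_rcons ln !ltnS mn eqSS; case: ltngtP (mn) => // [mn' _|-> _].
  exact: lg.
by rewrite lz.
Qed.

Lemma prec_rel_iter (h : nat -> nat) xs n y :
  prec_rel (fun xs y => y = head 0 xs) (fun xs y => y = h (nth 0 xs 1)) xs n y <->
  y = iter n h (head 0 xs).
Proof.
elim: n y => [|n IHn] y //=; split=> [[z /IHn -> //]|->].
by eexists; first exact/IHn.
Qed.

Lemma definable_rel_head : definable_rel (fun xs y => y = head 0 xs).
Proof. by apply: definable_rel_iff (definable_rel_nth 0) => xs y; rewrite nth0. Qed.

(** Primitive recursion whose step ignores the counter and reads the previous value, at position
    1. *)
Lemma definable_iter (h : nat -> nat) : definable_rel (fun xs y => y = h (head 0 xs)) ->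
  forall E (c : ctx E) x n u, var c x -> var c n -> var c u ->
  definable c (fun e => u e = iter (n e) h (x e)).
Proof.
move=> hP E c x n u cx cn cu.
apply: (@definable_iff _ _ (fun e => prec_rel (fun xs y => y = head 0 xs)
  (fun xs y => y = h (nth 0 xs 1)) [:: x e] (n e) (u e))) => [e|].
  exact: prec_rel_iter.
apply: definable_rel_prec; [exact: definable_rel_head | | solve_var ..].
move=> E' c' us y cus cy.
apply: (@definable_iff _ _ (fun e => exists z, z = nth 0 (us e) 1 /\ y e = h z)) => [e|].
  by split=> [[_ [->]]|->] //; exists (nth 0 (us e) 1).
apply: definable_ex; apply: definable_and; first by apply: definable_rel_nth; solve_var.
by apply: (hP _ _ (fun p => [:: p.2])); solve_var.
Qed.

Lemma definable_rel_succ : definable_rel (fun xs y => y = (head 0 xs).+1).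
Proof.
move=> E c us u cus cu.
apply: (@definable_iff _ _ (fun e => exists z, z = head 0 (us e) /\ u e = z.+1)) => [e|].
  by split=> [[_ [->]]|->] //; exists (head 0 (us e)).
apply: definable_ex; apply: definable_and; last by apply: definable_succ; solve_var.
by apply: definable_rel_head; solve_var.
Qed.

(** With neither order nor addition among the predicates, [u < u'] is expressed by iterating
    successor from [(u e).+1]. *)
Lemma definable_lt E (c : ctx E) u u' : var c u -> var c u' -> definable c (fun e => u e < u' e).
Proof.
move=> cu cu'.
apply: (@definable_iff _ _ (fun e => exists n x, x = (u e).+1 /\ u' e = iter n succn x)) => [e|].
  split=> [[n [_ [->]]] ->|uu']; first by rewrite iter_succn leq_addr.
  by exists (u' e - (u e).+1), (u e).+1; rewrite iter_succn addnC subnK.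
apply: definable_ex; apply: definable_ex; apply: definable_and.
  by apply: definable_succ; solve_var.
by apply: (definable_iter definable_rel_succ); solve_var.
Qed.

(** * Recursive functions *)

(** Supplies induction hypotheses for the functions inside the list of [RComp]. *)
Lemma recfun_nested_ind (P : recfun -> Prop) :
  P RZero -> P RSucc -> (forall i, P (RProj i)) ->
  (forall f gs, P f -> List.Forall P gs -> P (RComp f gs)) ->
  (forall f g, P f -> P g -> P (RPrec f g)) -> (forall f, P f -> P (RMu f)) ->
  forall f, P f.
Proof.
move=> P0 PS Pproj Pcomp Pprec Pmu; fix IH 1 => -[||i|f gs|f g|f].
- exact: P0.
- exact: PS.
- exact: Pproj.
- apply: Pcomp (IH f) _; elim: gs => [|g gs IHgs]; first exact: List.Forall_nil.
  exact: List.Forall_cons (IH g) IHgs.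
- exact: Pprec (IH f) (IH g).
- exact: Pmu (IH f).
Qed.

Lemma reval_functional f xs y z : reval f xs y -> reval f xs z -> y = z.
Proof.
elim/recfun_nested_ind: f xs y z => [||i|f gs IHf IHgs|f g IHf IHg|f IHf] xs y z /=.
- by move=> -> ->.
- by move=> -> ->.
- by move=> -> ->.
- move=> [ys gys fys] [zs gzs fzs]; suff yzs : ys = zs.
    by rewrite yzs in fys; exact: IHf fys fzs.
  elim: gs IHgs ys zs gys gzs {fys fzs} => [|g gs IH] IHgs [|y' ys] [|z' zs] //=.
  move: IHgs => /List.Forall_cons_iff[IHg IHgs].
  by move=> [/IHg gy /IH gys] [/gy -> /gys ->].
- elim: (head 0 xs) y z => [|n IHn] y z /=; first exact: IHf.
  by move=> [y' /IHn yn gy] [z' /yn yz' gz]; rewrite -yz' in gz; exact: IHg gy gz.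
(* The smaller of two distinct results would have both the value 0 and, by minimality of the larger,
   a nonzero value. *)
- move=> [fy ylt] [fz zlt]; case: (ltngtP y z) => // [/zlt|/ylt] [k /IHf h].
    by have := h _ fy.
  by have := h _ fz.
Qed.

(** The list of intermediate results becomes one existential quantifier per inner function; [ws]
    accumulates those already bound. *)
Lemma definable_comp f gs : definable_rel (reval f) ->
  List.Forall (fun g => definable_rel (reval g)) gs ->
  forall E (c : ctx E) us ws u, vars c us -> vars c ws -> var c u ->
  definable c (fun e => exists2 zs, all_rel (fun g z => reval g (us e) z) gs zs &
    reval f (ws e ++ zs) (u e)).
Proof.
move=> fP; elim: gs => [|g gs IHgs] gsP E c us ws u cus cws cu.
  apply: definable_iff (fP _ _ _ _ cws cu) => e.
  by split=> [h|[[|//] _]]; [exists [::]; rewrite ?cats0 | rewrite cats0].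
move: gsP => /List.Forall_cons_iff[gP gsP].
apply: (@definable_iff _ _ (fun e => exists z, reval g (us e) z /\
  exists2 zs, all_rel (fun g z => reval g (us e) z) gs zs &
    reval f (rcons (ws e) z ++ zs) (u e))) => [e|].
  split=> [[z [gz [zs gszs fz]]]|[[//|z zs] /= [gz gszs] fz]].
    by exists (z :: zs); rewrite // -cat_rcons.
  by exists z; split=> //; exists zs; rewrite // cat_rcons.
apply: definable_ex; apply: definable_and; first by apply: gP; solve_var.
by apply: (IHgs gsP _ _ (fun p => us p.1) (fun p => rcons (ws p.1) p.2)); solve_var.
Qed.

(** The head of an empty list is no variable, so a fresh one stands for it. *)
Lemma definable_head E (c : ctx E) us : vars c us ->
  forall R : E -> nat -> Prop, definable (ext c) (fun p => R p.1 p.2) ->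
  definable c (fun e => R e (head 0 (us e))).
Proof.
move=> cus R cR; apply: (@definable_iff _ _ (fun e => exists n, n = head 0 (us e) /\ R e n)).
  by move=> e; split=> [[_ [->]]|] //; exists (head 0 (us e)).
apply: definable_ex; apply: definable_and => //.
by apply: definable_rel_head; solve_var.
Qed.

Lemma definable_reval f : definable_rel (reval f).
Proof.
elim/recfun_nested_ind: f => [||i|f gs IHf IHgs|f g IHf IHg|f IHf].
- exact: definable_rel_const.
- exact: definable_rel_succ.
- exact: definable_rel_nth.
- by move=> E c us u cus cu; exact: (definable_comp IHf IHgs cus (vars_nil c) cu).
- move=> E c us u cus cu.
  apply: (definable_head cus (R := fun e n =>
    prec_rel (reval f) (reval g) (behead (us e)) n (u e))).
  by apply: definable_rel_prec; [| |solve_var ..].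
- move=> E c us u cus cu; apply: definable_and.
    apply: (@definable_iff _ _ (fun e => exists z, z = 0 /\ reval f (u e :: us e) z)).
      by move=> e; split=> [[_ [->]]|] //; exists 0.
    apply: definable_ex; apply: definable_and; first by apply: definable_zero; solve_var.
    by apply: (IHf _ _ (fun p => u p.1 :: us p.1)); solve_var.
  apply: definable_all; apply: definable_imp; first by apply: definable_lt; solve_var.
  apply: (@definable_iff _ _ (fun p => exists k k', k' = k.+1 /\
      reval f (p.2 :: us p.1) k')).
    move=> p; split=> [[k [_ [->]]]|[k]]; first by exists k.
    by exists k, k.+1.
  apply: definable_ex; apply: definable_ex; apply: definable_and.
    by apply: definable_succ; solve_var.
  by apply: IHf; solve_var.
Qed.

(** * Definability of recursive sets *)

Definition definable_set (A : set nat) :=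
  forall E (c : ctx E) u, var c u -> definable c (fun e => A (u e)).

Lemma definable_recursive_set A : recursive_set A -> definable_set A.
Proof.
move=> [f fA] E c u cu.
apply: (@definable_iff _ _ (fun e => exists y, y = 1 /\ reval f [:: u e] y)) => [e|].
  split=> [[_ [->] fu]|Au]; last by exists 1; split=> //; exact: (fA _).1.
  (* Outside [A] the value would be 0 as well as 1. *)
  by apply: contrapT => /(fA _).2 /(reval_functional fu).
apply: definable_ex; apply: definable_and; last by apply: definable_reval; solve_var.
by apply: (definable_rel_const 1 (us := fun=> [::])); solve_var.
Qed.

(** * Theorems *)

Section Theorems.
Variable S : formal_system.

Definition inferable (l : seq nat) (x : nat) : Prop :=
  (code_form @` axioms S) x \/
  exists ps, (code_inference @` rules S) (code_pair (code_seq ps) x) /\ {subset ps <= l}.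

(** The latest formula comes first, so premises stand at larger positions. *)
Fixpoint derivation (l : seq nat) : Prop :=
  if l is x :: l' then inferable l' x /\ derivation l' else True.

Lemma sub_inferable l l' x : {subset l <= l'} -> inferable l x -> inferable l' x.
Proof.
move=> ll' [|[ps [rx psl]]]; [by left | right; exists ps; split=> // p /psl].
exact: ll'.
Qed.

Lemma derivation_cat l l' : derivation l -> derivation l' -> derivation (l ++ l').
Proof.
move=> + dl'; elim: l => //= x l IHl [lx /IHl]; split=> //.
by apply: sub_inferable lx => y; rewrite mem_cat => ->.
Qed.

Lemma derivation_sound l x :
  derivation l -> x \in l -> (code_form @` [set p | theorem_of S p]) x.
Proof.
elim: l x => //= y l IHl x [ly dl]; rewrite inE => /predU1P[{x}->|/IHl]; last exact.
case: ly => [[p Sp <-]|[ns [[[ps q] Spq]]]].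
  by exists p => //; exact: theorem_axiom.
move=> /code_pair_inj[/code_seq_inj <- <-] psl; exists q => //.
apply: theorem_rule Spq _ => p psp.
have : code_form p \in map code_form ps.
  by elim: (ps) psp => //= p' ps' IH [->|/IH]; rewrite inE ?eqxx // orbC => ->.
by move=> /psl/(IHl _ dl)[p' Sp' /code_form_inj <-].
Qed.

Lemma derivation_complete p :
  theorem_of S p -> exists2 l, derivation l & code_form p \in l.
Proof.
elim=> [{}p Sp|ps q Spq _ IHps].
  by exists [:: code_form p]; rewrite ?inE //=; split=> //; left; exists p.
have [l dl psl] : exists2 l, derivation l & {subset map code_form ps <= l}.
  elim: ps IHps {Spq} => [|p' ps IH] IHps; first by exists [::].
  have [|l dl psl] := IH; first by move=> p'' psp; apply: IHps; right.
  have [|l' dl' p'l] := IHps p'; first by left.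
  exists (l' ++ l); first exact: derivation_cat.
  by move=> x; rewrite inE mem_cat => /predU1P[->|/psl ->]; rewrite ?p'l ?orbT.
exists (code_form q :: l); rewrite ?mem_head //=; split=> //.
by right; exists (map code_form ps); split=> //; exists (ps, q).
Qed.

(** Replaces recursion on the list by conditions on positions and codes, the form in which
    definability can be checked. *)
Lemma derivationP l : derivation l <->
  forall i x, seq_nth (code_seq l) i x -> (code_form @` axioms S) x \/
    exists ps r, r = code_pair ps x /\ ((code_inference @` rules S) r /\
      forall j y, seq_nth ps j y -> exists k, i < k /\ seq_nth (code_seq l) k y).
Proof.
have dropP i y : y \in drop i.+1 l <-> exists k, i < k /\ seq_nth (code_seq l) k y.
  split=> [/(nthP 0)[k]|[k []]].
    rewrite size_drop nth_drop ltn_subRL => kl <-; exists (i.+1 + k).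
    by rewrite seq_nth_code kl leq_addr.
  rewrite seq_nth_code => ik [kl <-].
  by rewrite -(subnKC ik) -nth_drop mem_nth // size_drop ltn_sub2r // (leq_ltn_trans ik).
have inferableP i x : inferable (drop i.+1 l) x <-> (code_form @` axioms S) x \/
    exists ps r, r = code_pair ps x /\ ((code_inference @` rules S) r /\
      forall j y, seq_nth ps j y -> exists k, i < k /\ seq_nth (code_seq l) k y).
  split=> -[|[ps]]; try by left.
    move=> [rx psl]; right; exists (code_seq ps), (code_pair (code_seq ps) x).
    split=> //; split=> // j y; rewrite seq_nth_code => -[jps <-].
    by apply/dropP/psl; rewrite mem_nth.
  move=> [r [-> [rx psl]]]; right; have [ns psE] := code_seq_surj ps; subst ps.
  exists ns; split=> // y /(nthP 0)[j jn yE].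
  by apply/dropP/psl; rewrite seq_nth_code; split; first exact: jn.
have -> : derivation l <-> forall i, i < size l -> inferable (drop i.+1 l) (nth 0 l i).
  elim: l {dropP inferableP} => //= x l IHl; split=> [[lx /IHl dl] [|i]|h].
  - by rewrite /= drop0.
  - exact: dl.
  - by split; [have := h 0; rewrite /= drop0; exact|apply/IHl => i; exact: h i.+1].
split=> [h i x|h i il]; last by apply/inferableP/h; rewrite seq_nth_code.
by rewrite seq_nth_code => -[/h + <-] => /inferableP.
Qed.

Lemma definable_theorems : decidable_system S ->
  definable_set (code_form @` [set p | theorem_of S p]).
Proof.
move=> [/definable_recursive_set axP /definable_recursive_set ruleP] E c u cu.
apply: (@definable_iff _ _ (fun e => exists l, (exists i, seq_nth l i (u e)) /\
  forall i x, seq_nth l i x -> (code_form @` axioms S) x \/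
    exists ps r, r = code_pair ps x /\ ((code_inference @` rules S) r /\
      forall j y, seq_nth ps j y -> exists k, i < k /\ seq_nth l k y))) => [e|].
  split=> [[s [[i]]]|[p /derivation_complete[l dl pl] <-]].
    have [l ->] := code_seq_surj s; rewrite seq_nth_code => -[il <-] /derivationP dl.
    by apply: derivation_sound dl _; rewrite mem_nth.
  exists (code_seq l); split; last exact/derivationP.
  by have [i il <-] := nthP 0 pl; exists i; rewrite seq_nth_code.
apply: definable_ex; apply: definable_and.
  by apply: definable_ex; apply: definable_nth; solve_var.
do 2![apply: definable_all]; apply: definable_imp; first by apply: definable_nth; solve_var.
apply: definable_or; first by apply: axP; solve_var.
do 2![apply: definable_ex]; apply: definable_and; first by apply: definable_pair; solve_var.
apply: definable_and; first by apply: ruleP; solve_var.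
do 2![apply: definable_all]; apply: definable_imp; first by apply: definable_nth; solve_var.
apply: definable_ex; apply: definable_and; first by apply: definable_lt; solve_var.
by apply: definable_nth; solve_var.
Qed.

End Theorems.

(** * Diagonalisation *)

(** Says [p] of the successor of variable 0 by rebinding that variable. No substitution is involved,
    so the code of the result is obtained by pairing alone. *)
Definition shift (p : form) : form :=
  All 1 (Imp (Succ 0 1) (All 0 (Imp (Equal 1 0) p))).

(** There are no numerals: [n] shifts starting from zero make [p] speak of [n]. *)
Definition at_numeral (n : nat) (p : form) : form :=
  Imp arith (All 0 (Imp (Zero 0) (iter n shift p))).

Definition shift_code (n : nat) : nat :=
  code_pair 4 (code_pair 1 (code_pair 2 (code_pair (code_form (Succ 0 1))
    (code_pair 4 (code_pair 0 (code_pair 2 (code_pair (code_form (Equal 1 0)) n))))))).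

(** The diagonal function: if [n] codes a formula, this is the code of that formula applied to [n]
    itself. *)
Definition self_code (n : nat) : nat :=
  code_pair 2 (code_pair (code_form arith) (code_pair 4 (code_pair 0
    (code_pair 2 (code_pair (code_form (Zero 0)) (iter n shift_code n)))))).

Lemma code_imp p q : code_form (Imp p q) = code_pair 2 (code_pair (code_form p) (code_form q)).
Proof. by []. Qed.

Lemma code_all x p : code_form (All x p) = code_pair 4 (code_pair x (code_form p)).
Proof. by []. Qed.

Lemma code_shift n p : code_form (iter n shift p) = iter n shift_code (code_form p).
Proof.
elim: n => [|n IHn]; first by [].
rewrite [in LHS]iterS [in RHS]iterS -IHn /shift /shift_code.
by rewrite code_all code_imp code_all code_imp.
Qed.

Lemma code_at_numeral p : code_form (at_numeral (code_form p) p) = self_code (code_form p).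
Proof. by rewrite /at_numeral /self_code code_imp code_all code_imp code_shift. Qed.

Lemma definable_self_code : definable_rel (fun xs y => y = self_code (head 0 xs)).
Proof.
do 6![apply: definable_rel_pair; first exact: definable_rel_const].
move=> E c us u cus cu; apply: (definable_head cus (R := fun e n => u e = iter n shift_code n)).
apply: definable_iter; [|solve_var ..].
(* Eight constant components surround the argument of [shift_code], as six surround the iteration in
   [self_code]. *)
do 8![apply: definable_rel_pair; first exact: definable_rel_const].
exact: definable_rel_head.
Qed.

Lemma sat_at_numeral F (I : interp F) w v (A : set nat) p n g :
  std I w v ->
  (forall g, ldom w (g 0) -> sat I p g w <-> A (v (g 0))) -> sat I arith g w ->
  sat I (at_numeral n p) g w <-> A n.
Proof.
move=> [vsurj vP] pA sg.
(* Each shift raises the value of variable 0 by one, whichever element of that value the quantifiers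
   pick. *)
have shiftP m g' : ldom w (g' 0) -> sat I (iter m shift p) g' w <-> A (m + v (g' 0)).
  elim: m g' => [|m IHm] g' d0; first exact: pA.
  rewrite iterS; split.
    have [a da aE] := vsurj (v (g' 0)).+1.
    move=> /sat_all/(_ a da)/sat_imp; rewrite /= map_tupleE /=.
    have [_ Sa _ _ _] := vP _ a a d0 da da; move=> /(_ (Sa.2 aE))/(_ a da).
    rewrite map_tupleE /=; have [_ _ Ea _ _] := vP _ _ a da da da.
    by move=> /(_ (Ea.2 erefl))/IHm; rewrite /= aE addnS; exact.
  move=> Am a da; rewrite /= map_tupleE /=.
  have [_ Sa _ _ _] := vP _ a a d0 da da; move=> /Sa aE b db.
  rewrite map_tupleE /=; have [_ _ Eb _ _] := vP _ _ a da db da; move=> /Eb abE.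
  by apply/IHm => //=; rewrite -abE aE addnS.
split=> [/sat_imp/(_ sg)|An _ a da].
  have [a da a0] := vsurj 0; move=> /sat_all/(_ a da)/sat_imp.
  rewrite /= map_tupleE /=; have [Za _ _ _ _] := vP a a a da da da.
  by move=> /(_ (Za.2 a0))/shiftP; rewrite /= a0 addn0; exact.
rewrite /= map_tupleE /=; have [Za _ _ _ _] := vP a a a da da da.
by move=> /Za a0; apply/shiftP; rewrite //= a0 addn0.
Qed.

Theorem corollary5 : ~ recursively_axiomatizable (logic_of stalnakerian).
Proof.
move=> [S decS LE]; pose T := code_form @` [set p | theorem_of S p].
have [p pP] : definable (Ctx 1 (fun n _ => n)) (fun n => ~ T (self_code n)).
  apply: definable_not.
  apply: (@definable_iff _ _ (fun n => exists y, y = self_code n /\ T y)) => [n|].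
    by split=> [[_ [->]]|] //; exists (self_code n).
  apply: definable_ex; apply: definable_and; last first.
    by apply: (definable_theorems decS); solve_var.
  apply: (definable_self_code (us := fun p => [:: p.1])); last exact: var_last.
  apply: vars_cons; last exact: vars_nil.
  by apply: (@var_ext _ _ id) => //; exists 0.
have {}pP F (I : interp F) w v g : std I w v -> ldom w (g 0) ->
    sat I p g w <-> ~ T (self_code (v (g 0))).
  by move=> st d0; apply: (pP _ _ _ _ st) => -[].
(* [q] is the Gödel sentence: its code is [self_code n], the number of which [p] at [n] denies
   theoremhood. *)
pose n := code_form p; pose q := at_numeral n p.
have Tq : T (self_code n) <-> theorem_of S q.
  rewrite -code_at_numeral; split=> [[q0 Sq0 /code_form_inj qE]|Sq]; first by rewrite /q /n -qE.
  by exists q.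
have qP F (I : interp F) w v g : std I w v -> sat I arith g w ->
    sat I q g w <-> ~ theorem_of S q.
  move=> st sg; rewrite -Tq.
  by apply: (sat_at_numeral (A := fun n => ~ T (self_code n)) n st _ sg) => g'; exact: pP.
(* A theorem would be valid, hence true at world 0 of the standard model, where [q] says that it is
   no theorem. *)
have : ~ theorem_of S q.
  move=> Sq; have : logic_of stalnakerian q by rewrite LE.
  move=> /(_ _ nat_frame_stalnakerian nat_interp 0 id).
  by move=> /(qP _ _ _ _ _ nat_interp_std (@nat_interp_arith id)).
(* Not being a theorem makes [q] true wherever [arith] holds, as such worlds are standard; elsewhere
   [q] holds vacuously. So it is valid after all. *)
move=> nSq; apply: (nSq); suff : logic_of stalnakerian q by rewrite LE.
move=> F stF I w g; case: (pselect (sat I arith g w)) => [sg|nsg].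
  have [v st] := std_of_arith stF (ex_intro _ g sg).
  exact/(qP _ _ _ _ _ st sg).
by move=> /nsg.
Qed.
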